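(* Let $\tau>0$, $M\ge0$, and let a quadrature rule on $[0,1]$ with distinct points $\widehat\xi_i$ and positive weights $\widehat\omega_i>0$, $i=1,\dots,Q$, be given. Let discrete closed curves $\Gamma_h^m=\boldsymbol Y_h^m(\widehat\Gamma_h)$ of degree $\ell\ge1$ be generated from a given $\boldsymbol Y_h^0$ as follows: for each $m=0,\dots,M$, the curve $\Gamma_h^m$ satisfies ($\mathcal A1^h$): $|\nabla\boldsymbol F_{h,j}^m(\widehat\xi_i)|>0$ for all $j=1,\dots,N$, $i=1,\dots,Q$; the pair $(\boldsymbol X_h^{m+1},\kappa_h^{m+1})\in[\mathbb V_\ell^m]^2\times\mathbb V_\ell^m$ is a solution of $$\Big(\frac{\boldsymbol X_h^{m+1}-\mathrm{id}}{\tau},\varphi_h\boldsymbol n_h^m\Big)^h_{\Gamma_h^m}=\begin{cases}(\kappa_h^{m+1},\varphi_h)^h_{\Gamma_h^m}, & \text{MCF},\\ (\nabla_s\kappa_h^{m+1},\nabla_s\varphi_h)^h_{\Gamma_h^m}, & \text{SD},\end{cases}\qquad (\kappa_h^{m+1}\boldsymbol n_h^m,\boldsymbol\eta_h)^h_{\Gamma_h^m}+(\nabla_s\boldsymbol X_h^{m+1},\nabla_s\boldsymbol\eta_h)^h_{\Gamma_h^m}=0$$ for all $\varphi_h\in\mathbb V_\ell^m$, $\boldsymbol\eta_h\in[\mathbb V_\ell^m]^2$ (with the same choice, MCF or SD, for all $m$); and $\boldsymbol Y_h^{m+1}=\boldsymbol X_h^{m+1}\circ\boldsymbol Y_h^m$.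 Then $$L_h^{M+1}\le L_h^0-\begin{cases}\tau\sum_{m=0}^M(\kappa_h^{m+1},\kappa_h^{m+1})^h_{\Gamma_h^m}, & \text{MCF},\\ \tau\sum_{m=0}^M(\nabla_s\kappa_h^{m+1},\nabla_s\kappa_h^{m+1})^h_{\Gamma_h^m}, & \text{SD},\end{cases}$$ where $L_h^m=(1,1)^h_{\Gamma_h^m}$ is the numerical perimeter of $\Gamma_h^m$.
   Context: Reference grid. $\widehat{\mathbb K}=[0,1]$; $\widehat\Gamma_h=\bigcup_{j=1}^N\widehat\sigma_j\subset\mathbb R^2$ is a closed polygonal curve with segments $\widehat\sigma_j=A_j(\widehat{\mathbb K})$, $A_j$ injective affine maps; $\widehat{\boldsymbol\tau}$ is the (piecewise constant) unit tangent of the oriented curve $\widehat\Gamma_h$ and $\partial_{\widehat{\boldsymbol\tau}}$ the directional derivative along it. $\mathbb P^\ell$ denotes polynomials of degree $\le\ell$. Discrete curve. $\boldsymbol Y_h^m:\widehat\Gamma_h\to\mathbb R^2$ is continuous with $\boldsymbol Y_h^m|_{\widehat\sigma_j}\in[\mathbb P^\ell(\widehat\sigma_j)]^2$ for each $j$; $\boldsymbol F_{h,j}^m=\boldsymbol Y_h^m|_{\widehat\sigma_j}\circ A_j$, and $\Gamma_h^m=\boldsymbol Y_h^m(\widehat\Gamma_h)$. Functions on $\Gamma_h^m$ are identified with their pull-backs under $\boldsymbol Y_h^m$ to $\widehat\Gamma_h$. The finite element space is $$\mathbb V_\ell^m=\{v_h\in H^1(\Gamma_h^m): v_h\circ\boldsymbol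 Y_h^m|_{\widehat\sigma_j}\in\mathbb P^\ell(\widehat\sigma_j),\ j=1,\dots,N\},$$ i.e. the functions whose pull-back $v_h\circ\boldsymbol Y_h^m$ is continuous on $\widehat\Gamma_h$ and polynomial of degree $\le\ell$ on each segment. $\mathrm{id}$ is the identity on $\Gamma_h^m$ (pull-back $\boldsymbol Y_h^m$). Geometry (piecewise, wherever $|\partial_{\widehat{\boldsymbol\tau}}\boldsymbol Y_h^m|>0$). $\boldsymbol n_h^m\circ\boldsymbol Y_h^m=(\partial_{\widehat{\boldsymbol\tau}}\boldsymbol Y_h^m)^\perp/|\partial_{\widehat{\boldsymbol\tau}}\boldsymbol Y_h^m|$, where $(\cdot)^\perp$ is rotation by a right angle, of fixed sense (chosen so that $\boldsymbol n_h^m$ is the outer normal). $\boldsymbol\tau^m$ is the unit tangent of $\Gamma_h^m$, and $\nabla_s f=(\partial_{\boldsymbol\tau^m}f)\,\boldsymbol\tau^m$ (for vector-valued $f$, $\nabla_s f=\partial_{\boldsymbol\tau^m}f\otimes\boldsymbol\tau^m$), where $(\partial_{\boldsymbol\tau^m}f)\circ\boldsymbol Y_h^m=\partial_{\widehat{\boldsymbol\tau}}(f\circ\boldsymbol Y_h^m)/|\partial_{\widehat{\boldsymbol\tau}}\boldsymbol Y_h^m|$. Quadrature. $\int^h_{\widehat{\mathbb K}}f\,\mathrm d\widehat x=\sum_{i=1}^Q f(\widehat\xi_i)\widehat\omega_i$, and $$(u,v)^h_{\Gamma_h^m}=\sum_{j=1}^N\sum_{i=1}^Q (u\circ\boldsymbol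 F_{h,j}^m)(\widehat\xi_i)\cdot(v\circ\boldsymbol F_{h,j}^m)(\widehat\xi_i)\,|\nabla\boldsymbol F_{h,j}^m(\widehat\xi_i)|\,\widehat\omega_i$$ (product, Euclidean or Frobenius inner product for scalars, vectors, matrices; piecewise-defined quantities are evaluated from within element $j$; $|\nabla\boldsymbol F_{h,j}^m|$ is the Euclidean norm of the derivative). MCF = curvature flow, SD = surface diffusion of curves. *)

(* Defs.v *)
From HB Require Import structures.
From mathcomp Require Import all_boot all_order all_algebra.
From mathcomp Require Import all_classical all_reals all_analysis.
Set Implicit Arguments.
Unset Strict Implicit.
Unset Printing Implicit Defensive.
Import Order.TTheory GRing.Theory Num.Theory.
Import numFieldNormedType.Exports.
Local Open Scope classical_set_scope.
Local Open Scope ring_scope.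

(* The norm `|_| of MathComp-Analysis on matrices is the max norm, hence the
   explicit Euclidean one. *)
Definition frob (R : realType) (p q : nat) (A B : 'M[R]_(p, q)) : R :=
  \sum_(i < p) \sum_(k < q) A i k * B i k.

Definition enorm (R : realType) (p q : nat) (A : 'M[R]_(p, q)) : R :=
  Num.sqrt (frob A A).

(* Rotation by a right angle; the boolean [s] fixes its sense:
   (v0, v1) |-> (- v1, v0) if [s = false] and (v1, - v0) if [s = true]. *)
Definition perp (R : realType) (s : bool) (v : 'cV[R]_2) : 'cV[R]_2 :=
  (-1) ^+ s *: \col_(k < 2) (if k == ord0 then - v ord_max 0 else v ord0 0).

Definition outer (R : realType) (a b : 'cV[R]_2) : 'M[R]_2 := a *m b^T.

(* Same as the library's [derive], except that only increments staying in [S]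
   are considered: it is one-sided at the endpoints of a segment [S], and does
   not see the values of [f] outside [S]. *)
Definition derive_in (R : realType) (V W : normedModType R) (S : set V)
    (f : V -> W) (a v : V) : W :=
  lim ((fun h : R => h^-1 *: (f (a + h *: v) - f a)) @
         within [set h | S (a + h *: v)] 0^').

(* A closed polygonal curve, oriented by the cyclic order of its vertices.
   The j-th segment joins [vertex j] to [vertex (ordS j)]; its parametrization
   [refmap j] may run along it in either direction. *)
Record ref_grid (R : realType) (N : nat) := RefGrid {
  vertex : 'I_N -> 'cV[R]_2;
  refmap : 'I_N -> R -> 'cV[R]_2;
  refmap_affine : forall j, exists a b : 'cV[R]_2,
    forall x, refmap j x = a + x *: b;
  refmap_inj : forall j, injective (refmap j);
  refmap_ends : forall j,
    (refmap j 0 = vertex j /\ refmap j 1 = vertex (ordS j)) \/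
    (refmap j 0 = vertex (ordS j) /\ refmap j 1 = vertex j)
}.

Record quadrature (R : realType) (Q : nat) := Quadrature {
  qpoint : 'I_Q -> R;
  qweight : 'I_Q -> R;
  qpoint_in : forall i, 0 <= qpoint i <= 1;
  qpoint_inj : injective qpoint;
  qweight_gt0 : forall i, 0 < qweight i
}.

Definition segment (R : realType) (N : nat) (G : ref_grid R N) (j : 'I_N) :
  set 'cV[R]_2 := refmap G j @` `[0, 1].

Definition ref_curve (R : realType) (N : nat) (G : ref_grid R N) :
  set 'cV[R]_2 := \bigcup_(j in [set: 'I_N]) segment G j.

Definition ref_tangent (R : realType) (N : nat) (G : ref_grid R N) (j : 'I_N) :
    'cV[R]_2 :=
  let e := vertex G (ordS j) - vertex G j in (enorm e)^-1 *: e.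

(* Functions on the discrete curve are represented by their pull-backs to
   [ref_curve G], so that the finite element space does not depend on the
   curve.  Functions are total on R^2, but only their values on [ref_curve G]
   matter.  As [refmap G j] is affine and injective, [f] is a polynomial of
   degree <= l on the segment iff [f \o refmap G j] is one on [0, 1]. *)
Definition fe_space (R : realType) (N : nat) (G : ref_grid R N) (l : nat)
    (f : 'cV[R]_2 -> R) : Prop :=
  {within ref_curve G, continuous f} /\
  forall j : 'I_N, exists2 p : {poly R}, (size p <= l.+1)%N &
    forall x : R, 0 <= x <= 1 -> f (refmap G j x) = p.[x].

Definition fe_space2 (R : realType) (N : nat) (G : ref_grid R N) (l : nat)
    (f : 'cV[R]_2 -> 'cV[R]_2) : Prop :=
  forall k : 'I_2, fe_space G l (fun y => f y k 0).

(* Piecewise defined quantities are functions of the element [j] and of the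
   parameter [x] in [0, 1], their value being the one at [refmap G j x] from
   within element [j]. *)
Definition pull (R : realType) (N : nat) (G : ref_grid R N) (T : Type)
    (f : 'cV[R]_2 -> T) (j : 'I_N) (x : R) : T := f (refmap G j x).

Definition ref_dtau (R : realType) (N : nat) (G : ref_grid R N)
    (W : normedModType R) (f : 'cV[R]_2 -> W) (j : 'I_N) (x : R) : W :=
  derive_in (segment G j) f (refmap G j x) (ref_tangent G j).

(* Derivative of F_j = Y \o refmap G j on [0, 1]. *)
Definition gradF (R : realType) (N : nat) (G : ref_grid R N)
    (Y : 'cV[R]_2 -> 'cV[R]_2) (j : 'I_N) (x : R) : 'cV[R]_2 :=
  derive_in (`[0, 1] : set R) (Y \o refmap G j) x 1.

Definition assumption_A1h (R : realType) (N Q : nat) (G : ref_grid R N)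
    (qr : quadrature R Q) (Y : 'cV[R]_2 -> 'cV[R]_2) : Prop :=
  forall (j : 'I_N) (i : 'I_Q), 0 < enorm (gradF G Y j (qpoint qr i)).

Definition normal (R : realType) (N : nat) (G : ref_grid R N) (s : bool)
    (Y : 'cV[R]_2 -> 'cV[R]_2) (j : 'I_N) (x : R) : 'cV[R]_2 :=
  (enorm (ref_dtau G Y j x))^-1 *: perp s (ref_dtau G Y j x).

Definition tangent (R : realType) (N : nat) (G : ref_grid R N)
    (Y : 'cV[R]_2 -> 'cV[R]_2) (j : 'I_N) (x : R) : 'cV[R]_2 :=
  (enorm (ref_dtau G Y j x))^-1 *: ref_dtau G Y j x.

Definition dtau (R : realType) (N : nat) (G : ref_grid R N)
    (Y : 'cV[R]_2 -> 'cV[R]_2) (W : normedModType R) (f : 'cV[R]_2 -> W)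
    (j : 'I_N) (x : R) : W :=
  (enorm (ref_dtau G Y j x))^-1 *: ref_dtau G f j x.

Definition sgrad (R : realType) (N : nat) (G : ref_grid R N)
    (Y : 'cV[R]_2 -> 'cV[R]_2) (f : 'cV[R]_2 -> R) (j : 'I_N) (x : R) :
  'cV[R]_2 := dtau G Y f j x *: tangent G Y j x.

Definition sgrad2 (R : realType) (N : nat) (G : ref_grid R N)
    (Y : 'cV[R]_2 -> 'cV[R]_2) (f : 'cV[R]_2 -> 'cV[R]_2) (j : 'I_N) (x : R) :
  'M[R]_2 := outer (dtau G Y f j x) (tangent G Y j x).

(* [ip] is the product, Euclidean or Frobenius inner product. *)
Definition qprod (R : realType) (N Q : nat) (G : ref_grid R N)
    (qr : quadrature R Q) (Y : 'cV[R]_2 -> 'cV[R]_2) (T : Type)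
    (ip : T -> T -> R) (u v : 'I_N -> R -> T) : R :=
  \sum_(j < N) \sum_(i < Q)
    ip (u j (qpoint qr i)) (v j (qpoint qr i)) *
    enorm (gradF G Y j (qpoint qr i)) * qweight qr i.

Definition qprod_scal (R : realType) (N Q : nat) (G : ref_grid R N)
    (qr : quadrature R Q) (Y : 'cV[R]_2 -> 'cV[R]_2) (u v : 'I_N -> R -> R) :
  R := qprod G qr Y *%R u v.

Definition qprod_mx (R : realType) (N Q : nat) (G : ref_grid R N)
    (qr : quadrature R Q) (Y : 'cV[R]_2 -> 'cV[R]_2) (p q : nat)
    (u v : 'I_N -> R -> 'M[R]_(p, q)) : R := qprod G qr Y (@frob R p q) u v.

Definition perimeter (R : realType) (N Q : nat) (G : ref_grid R N)
    (qr : quadrature R Q) (Y : 'cV[R]_2 -> 'cV[R]_2) : R :=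
  qprod_scal G qr Y (fun _ _ => 1) (fun _ _ => 1).

Inductive flow := MCF | SD.

Definition flow_form (R : realType) (N Q : nat) (G : ref_grid R N)
    (qr : quadrature R Q) (fl : flow) (Y : 'cV[R]_2 -> 'cV[R]_2)
    (f g : 'cV[R]_2 -> R) : R :=
  match fl with
  | MCF => qprod_scal G qr Y (pull G f) (pull G g)
  | SD => qprod_mx G qr Y (sgrad G Y f) (sgrad G Y g)
  end.

(* One time step: [Y] is the current curve (the pull-back of its identity
   map), ([X], [kappa]) the new position and curvature. *)
Definition scheme_step (R : realType) (N Q : nat) (G : ref_grid R N)
    (qr : quadrature R Q) (l : nat) (fl : flow) (s : bool) (tau : R)
    (Y X : 'cV[R]_2 -> 'cV[R]_2) (kappa : 'cV[R]_2 -> R) : Prop :=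
  [/\ fe_space2 G l X,
      fe_space G l kappa,
      forall phi : 'cV[R]_2 -> R, fe_space G l phi ->
        qprod_mx G qr Y
          (pull G (fun y => tau^-1 *: (X y - Y y)))
          (fun j x => pull G phi j x *: normal G s Y j x)
        = flow_form G qr fl Y kappa phi &
      forall eta : 'cV[R]_2 -> 'cV[R]_2, fe_space2 G l eta ->
        qprod_mx G qr Y
          (fun j x => pull G kappa j x *: normal G s Y j x) (pull G eta)
        + qprod_mx G qr Y (sgrad2 G Y X) (sgrad2 G Y eta) = 0].

(* Main.v *)
Require Import Defs.
From HB Require Import structures.
From mathcomp Require Import all_boot all_order all_algebra.
From mathcomp Require Import all_classical all_reals all_analysis.
From mathcomp Require Import ring lra.
Set Implicit Arguments.
Unset Strict Implicit.
Unset Printing Implicit Defensive.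
Import Order.TTheory GRing.Theory Num.Theory.
Import numFieldNormedType.Exports.
Local Open Scope classical_set_scope.
Local Open Scope ring_scope.

(** The estimate is the usual energy argument: test one time step with
    phi = kappa in the first equation and eta = X - Y in the second.  Since the
    quadrature form is symmetric, the two curvature terms coincide up to the
    factor tau, and eliminating them leaves
      tau * flow_form kappa kappa + (grad X, grad (X - Y)) = 0,
    the gradients being surface gradients on the current curve Y.  It remains
    to bound the last product below by the growth L(X) - L(Y) of the numerical
    perimeter, which is done separately at each quadrature point
    ([sgrad2_length_ge]).  There, with a = X_s and the unit tangent t = Y_s, the
    integrand is a . (a - t), and
      a . (a - t) = (|a|^2 - 1 + |a - t|^2) / 2 >= (|a|^2 - 1) / 2 >= |a| - 1,
    while |a| |F_Y'| = |F_X'| is exactly the length density of the new curve.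
    No integration by parts occurs, which is why every quadrature rule with
    positive weights is admissible.

    The choice eta = X - Y is legitimate because Y itself lies in the finite
    element space: this is assumed for the initial curve, and is inherited by
    every later one, which agrees with some X on the reference curve.

    The analytic content is that the derivatives, defined as limits over the
    increments staying in a segment, are those of the underlying polynomials
    ([derive_in_poly]).  Hence they are linear in the function, and the
    derivative along the reference segment is a nonzero constant multiple,
    common to all functions on that segment, of the derivative in the parameter
    ([ref_dtau_gradF]); this constant cancels in the arc length derivatives. *)

(** * Frobenius product and Euclidean norm *)

Lemma frobC (R : realType) p q (A B : 'M[R]_(p, q)) : frob A B = frob B A.
Proof.
by apply: eq_bigr => i _; apply: eq_bigr => k _; rewrite mulrC.
Qed.

Lemma frobDl (R : realType) p q (A B C : 'M[R]_(p, q)) :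
  frob (A + B) C = frob A C + frob B C.
Proof.
rewrite -big_split; apply: eq_bigr => i _; rewrite -big_split.
by apply: eq_bigr => k _; rewrite !mxE mulrDl.
Qed.

Lemma frobZl (R : realType) p q (c : R) (A B : 'M[R]_(p, q)) :
  frob (c *: A) B = c * frob A B.
Proof.
rewrite mulr_sumr; apply: eq_bigr => i _; rewrite mulr_sumr.
by apply: eq_bigr => k _; rewrite !mxE mulrA.
Qed.

Lemma frob_ge0 (R : realType) p q (A : 'M[R]_(p, q)) : 0 <= frob A A.
Proof.
by apply: sumr_ge0 => i _; apply: sumr_ge0 => k _; rewrite -expr2 sqr_ge0.
Qed.

Lemma enorm_ge0 (R : realType) p q (A : 'M[R]_(p, q)) : 0 <= enorm A.
Proof. exact: sqrtr_ge0. Qed.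

Lemma sqr_enorm (R : realType) p q (A : 'M[R]_(p, q)) :
  enorm A ^+ 2 = frob A A.
Proof. by rewrite sqr_sqrtr ?frob_ge0. Qed.

Lemma enormZ (R : realType) p q (c : R) (A : 'M[R]_(p, q)) :
  enorm (c *: A) = `|c| * enorm A.
Proof.
rewrite /enorm frobZl frobC frobZl mulrA -expr2 sqrtrM ?sqr_ge0 //.
by rewrite sqrtr_sqr.
Qed.

Lemma enorm_gt0 (R : realType) p q (A : 'M[R]_(p, q)) :
  A != 0 -> 0 < enorm A.
Proof.
move=> A0; rewrite lt_def enorm_ge0 andbT; apply: contraNneq A0 => nA0.
have /eqP := sqr_enorm A; rewrite nA0 expr0n /= eq_sym psumr_eq0; last first.
  by move=> i _; apply: sumr_ge0 => k _; rewrite -expr2 sqr_ge0.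
move=> /allP hA; apply/eqP/matrixP => i k; rewrite mxE.
have := hA i (mem_index_enum i); rewrite psumr_eq0 => [/allP hi|? _]; last first.
  by rewrite -expr2 sqr_ge0.
by have := hi k (mem_index_enum k); rewrite mulf_eq0 orbb => /eqP.
Qed.

Lemma frob_outer (R : realType) (a b t : 'cV[R]_2) :
  frob (outer a t) (outer b t) = frob a b * frob t t.
Proof.
rewrite /frob /outer !big_ord_recr !big_ord0 /= !mxE.
by rewrite !big_ord_recr !big_ord0 /= !mxE; ring.
Qed.

(** Polarization gives 2 a . (a - t) = |a|^2 - |t|^2 + |a - t|^2, and
    |a|^2 - 1 >= 2 (|a| - 1). *)
Lemma frob_sub_unit_ge (R : realType) (a t : 'cV[R]_2) :
  frob t t = 1 -> enorm a - 1 <= frob a (a - t).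
Proof.
move=> t1; have := sqr_enorm a; have := frob_ge0 (a - t).
have neg b : frob (- t) b = - frob t b by rewrite -scaleN1r frobZl mulN1r.
rewrite !(frobDl, neg) ![frob _ (a - t)]frobC !(frobDl, neg) t1 (frobC a t).
have := sqr_ge0 (enorm a - 1); nra.
Qed.

(** * One-sided derivatives of piecewise polynomials *)

(** Uniqueness of limits, hence the meaning of [derive_in], requires that [x]
    can be approached from within the segment, endpoints included. *)
Lemma within_segment_proper (R : realType) (x c : R) :
  0 <= x <= 1 -> c != 0 ->
  ProperFilter (within [set h : R | 0 <= x + h * c <= 1] 0^').
Proof.
move=> /andP[x0 x1] c0; apply: Build_ProperFilter_ex => P.
rewrite /within /= => /nbhs_ballP [e /= e0 he].
have nc0 : 0 < `|c| by rewrite normr_gt0.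
(* the increment of the parameter points to the farther endpoint *)
pose s : R := if x <= 2^-1 then 1 else -1.
pose d := Num.min (e / 2) (2^-1 / `|c|).
have d0 : 0 < d by rewrite lt_min !divr_gt0.
have dc : d * `|c| <= 2^-1 by rewrite -ler_pdivlMr // ge_min lexx orbT.
have dc0 : 0 < d * `|c| by rewrite mulr_gt0.
have hs : s = 1 /\ x <= 2^-1 \/ s = -1 /\ 2^-1 < x.
  by rewrite /s; case: (leP x 2^-1); [left|right].
have sn : `|s| = 1 by case: hs => -[-> _]; rewrite ?normrN normr1.
have s0 : s != 0 by rewrite -normr_gt0 sn.
exists (s * (d * (`|c| / c))); apply: he => /=.
- rewrite /ball /= sub0r normrN !normrM normfV normr_id sn mul1r divff ?gt_eqF //.
  rewrite mulr1 gtr0_norm //; apply: (@le_lt_trans _ _ (e / 2)); last lra.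
  by rewrite ge_min lexx.
- by rewrite !mulf_eq0 invr_eq0 !negb_or s0 c0 !gt_eqF.
- rewrite -!mulrA mulVf // mulr1; case: hs => -[-> hx]; lra.
Qed.


(** A planar curve with polynomial components; a function of the finite element
    space is of this form on each element. *)
Definition vhorner (R : realType) (p : 'I_2 -> {poly R}) (x : R) : 'cV[R]_2 :=
  \col_k (p k).[x].

Definition vderiv (R : realType) (p : 'I_2 -> {poly R}) : 'I_2 -> {poly R} :=
  fun k => (p k)^`().

Lemma vhorner_continuous (R : realType) (p : 'I_2 -> {poly R}) :
  continuous (vhorner p).
Proof.
move=> x.
have -> : vhorner p = (fun y => (p ord0).[y] *: (delta_mx ord0 0 : 'cV[R]_2)
                         + (p ord_max).[y] *: (delta_mx ord_max 0 : 'cV[R]_2)).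
  apply/funext => y; apply/matrixP => k i; rewrite !mxE (ord1 i) eqxx !andbT.
  case: k => -[|[|//]] hk; rewrite !eqE /= ?mulr0 ?mulr1 ?addr0 ?add0r;
  by congr (p _).[y]; exact: val_inj.
by apply: cvgD; apply: cvgZr_tmp; exact: continuous_horner.
Qed.

(** Dividing p - p(x) by 'X - x writes the difference quotient at [x] as a
    polynomial, so that its limit only needs continuity. *)
Lemma vhorner_factor (R : realType) (p : 'I_2 -> {poly R}) (x : R) :
  exists2 q : 'I_2 -> {poly R}, vhorner q x = vhorner (vderiv p) x &
    forall y, vhorner p y - vhorner p x = (y - x) *: vhorner q y.
Proof.
pose q k := (p k - (p k).[x]%:P) %/ ('X - x%:P).
have qE k : p k - (p k).[x]%:P = q k * ('X - x%:P).
  by rewrite divpK // dvdp_XsubCl /root !hornerE subrr.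
exists q => [|y]; apply/matrixP => k l; rewrite !mxE.
  have /(congr1 (fun r => r^`().[x])) := qE k.
  by rewrite derivB derivC derivM derivXsubC !hornerE subrr mulr0 add0r subr0.
have /(congr1 (fun r => r.[y])) := qE k.
by rewrite !hornerE mulrC.
Qed.

Lemma vhorner_diff_quotient (R : realType) (p : 'I_2 -> {poly R}) (x c : R) :
  h^-1 *: (vhorner p (x + h * c) - vhorner p x) @[h --> 0^'] -->
    c *: vhorner (vderiv p) x.
Proof.
have [q <- qE] := vhorner_factor p x.
apply: (@cvg_trans _ ((fun h : R => c *: vhorner q (x + h * c)) @ 0^')).
  apply: near_eq_cvg; near=> h.
  have h0 : h != 0 by near: h; exact: nbhs_dnbhs_neq.
  by rewrite qE (addrC x) addrK !scalerA mulrCA mulVKf // mulrC.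
apply: cvgZl_tmp; apply: cvg_trans (@vhorner_continuous R q x).
apply: (@cvg_comp _ _ _ (fun h => x + h * c) (vhorner q) _ (nbhs x)) => //.
apply: cvg_within_filter.
suff: x + h * c @[h --> nbhs (0 : R)] --> x + 0 * c by rewrite mul0r addr0.
apply: cvgD; [exact: cvg_cst | apply: cvgMr_tmp; exact: cvg_id].
Unshelve. all: by end_near.
Qed.

(** Common form of the derivative in the parameter ([c = 1]) and of the
    tangential derivative along a reference segment ([c] being the signed speed
    of the unit tangent in the parameter). *)
Lemma derive_in_poly (R : realType) (V : normedModType R) (S : set V)
    (f : V -> 'cV[R]_2) (a v : V) (p : 'I_2 -> {poly R}) (x c : R) :
  0 <= x <= 1 -> c != 0 ->
  (forall h : R, S (a + h *: v) <-> 0 <= x + h * c <= 1) ->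
  (forall h : R, 0 <= x + h * c <= 1 -> f (a + h *: v) = vhorner p (x + h * c)) ->
  derive_in S f a v = c *: vhorner (vderiv p) x.
Proof.
move=> x01 c0 hS hf; rewrite /derive_in.
have -> : [set h | S (a + h *: v)] = [set h : R | 0 <= x + h * c <= 1].
  by apply/seteqP; split => h /hS.
have PF := within_segment_proper x01 c0.
have fa : f a = vhorner p x.
  by have := hf 0; rewrite scale0r mul0r !addr0; exact.
apply/cvg_lim => //.
apply: (@cvg_trans _ ((fun h : R => h^-1 *: (vhorner p (x + h * c) - vhorner p x)) @
    within [set h : R | 0 <= x + h * c <= 1] 0^')).
  by apply: fmap_within_eq => h; rewrite inE /= => hx; rewrite hf // fa.
exact: cvg_within_filter (@vhorner_diff_quotient R p x c).
Qed.

(** * The finite element space on the reference curve *)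

Lemma segment_refmap (R : realType) (N : nat) (G : ref_grid R N) j (x : R) :
  segment G j (refmap G j x) <-> 0 <= x <= 1.
Proof.
split=> [[y]|x01]; last by exists x; rewrite //= in_itv /= x01.
by rewrite /= in_itv /= => y01 /(@refmap_inj _ _ G j) <-.
Qed.

Lemma fe_space_eq (R : realType) (N : nat) (G : ref_grid R N) l
    (f g : 'cV[R]_2 -> R) :
  (forall y, ref_curve G y -> f y = g y) -> fe_space G l f -> fe_space G l g.
Proof.
move=> fg [cf pf]; split.
  by apply: subspace_eq_continuous cf => y; rewrite inE => /fg.
move=> j; have [p sp fp] := pf j; exists p => // x x01.
by rewrite -fg ?fp //; exists j => //; apply/segment_refmap.
Qed.

Lemma fe_spaceB (R : realType) (N : nat) (G : ref_grid R N) l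
    (f g : 'cV[R]_2 -> R) :
  fe_space G l f -> fe_space G l g -> fe_space G l (fun y => f y - g y).
Proof.
move=> [cf pf] [cg pg]; split; first by move=> y; exact: cvgB (cf y) (cg y).
move=> j; have [p sp fp] := pf j; have [q sq gq] := pg j.
exists (p - q) => [|x x01]; last by rewrite fp // gq // !hornerE.
by rewrite (leq_trans (size_polyD _ _)) // size_polyN geq_max sp.
Qed.

Lemma fe_space2_eq (R : realType) (N : nat) (G : ref_grid R N) l
    (f g : 'cV[R]_2 -> 'cV[R]_2) :
  (forall y, ref_curve G y -> f y = g y) -> fe_space2 G l f -> fe_space2 G l g.
Proof. by move=> fg hf k; apply: fe_space_eq (hf k) => y /fg ->. Qed.

Lemma fe_space2B (R : realType) (N : nat) (G : ref_grid R N) l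
    (f g : 'cV[R]_2 -> 'cV[R]_2) :
  fe_space2 G l f -> fe_space2 G l g -> fe_space2 G l (fun y => f y - g y).
Proof.
move=> hf hg k; apply: fe_space_eq (fe_spaceB (hf k) (hg k)) => y _.
by rewrite !mxE.
Qed.

Lemma fe_space2_poly (R : realType) (N : nat) (G : ref_grid R N) l
    (f : 'cV[R]_2 -> 'cV[R]_2) (j : 'I_N) :
  fe_space2 G l f ->
  exists p, forall x, 0 <= x <= 1 -> f (refmap G j x) = vhorner p x.
Proof.
move=> hf.
have /choice[p hp] : forall k : 'I_2, exists p : {poly R},
    forall x, 0 <= x <= 1 -> f (refmap G j x) k 0 = p.[x].
  by move=> k; have [_ /(_ j)[p _ hp]] := hf k; exists p.
exists p => x x01; apply/matrixP => k i; rewrite (ord1 i) mxE; exact: hp.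
Qed.

(** The sign of [c] records whether [refmap G j] runs along the segment in the
    direction of the orientation; its modulus is the inverse of the length. *)
Lemma refmap_tangent (R : realType) (N : nat) (G : ref_grid R N) (j : 'I_N) :
  exists2 c : R, c != 0 &
    forall x h, refmap G j x + h *: ref_tangent G j = refmap G j (x + h * c).
Proof.
have [a [b ab]] := refmap_affine G j.
have b0 : b != 0.
  apply/eqP => b0; have : (0 : R) = 1.
    by apply: (@refmap_inj _ _ G j); rewrite !ab b0 !scaler0.
  by move/eqP; rewrite eq_sym oner_eq0.
set e := vertex G (ordS j) - vertex G j.
have [s s0 es] : exists2 s : R, s != 0 & e = s *: b.
  rewrite /e; case: (refmap_ends G j) => -[<- <-]; rewrite !ab scale0r scale1r addr0.
    by exists 1; rewrite ?oner_eq0 // scale1r addrC addKr.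
  by exists (-1); rewrite ?oppr_eq0 ?oner_eq0 // scaleN1r opprD addrA subrr add0r.
have ne0 : enorm e != 0 by rewrite gt_eqF // enorm_gt0 // es scaler_eq0 negb_or s0.
exists ((enorm e)^-1 * s) => [|x h]; first by rewrite mulf_neq0 ?invr_eq0.
by rewrite !ab scalerDl addrA /ref_tangent -/e es !scalerA mulrA.
Qed.

(** * Tangential derivatives *)

Lemma gradF_poly (R : realType) (N : nat) (G : ref_grid R N)
    (f : 'cV[R]_2 -> 'cV[R]_2) (j : 'I_N) p (x : R) :
  (forall x, 0 <= x <= 1 -> f (refmap G j x) = vhorner p x) -> 0 <= x <= 1 ->
  gradF G f j x = vhorner (vderiv p) x.
Proof.
move=> fp x01; rewrite -[RHS]scale1r; apply: derive_in_poly => // h h01; exact: fp.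
Qed.

(** The constant does not depend on the function, so it disappears from the
    quotients that define [dtau] and [tangent], up to a common sign. *)
Lemma ref_dtau_gradF (R : realType) (N : nat) (G : ref_grid R N) l (j : 'I_N) :
  exists2 c : R, c != 0 & forall f x, fe_space2 G l f -> 0 <= x <= 1 ->
    ref_dtau G f j x = c *: gradF G f j x.
Proof.
have [c c0 hc] := refmap_tangent G j; exists c => // f x hf x01.
have [p hp] := fe_space2_poly j hf; rewrite (gradF_poly hp x01).
apply: derive_in_poly => //= h; rewrite hc; first exact: segment_refmap.
exact: hp.
Qed.

Lemma gradF_eq (R : realType) (N : nat) (G : ref_grid R N) l
    (f g : 'cV[R]_2 -> 'cV[R]_2) (j : 'I_N) (x : R) :
  fe_space2 G l f -> (forall y, ref_curve G y -> f y = g y) -> 0 <= x <= 1 ->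
  gradF G f j x = gradF G g j x.
Proof.
move=> hf fg x01; have [p hp] := fe_space2_poly j hf.
rewrite (gradF_poly hp x01) (gradF_poly (p := p)) // => z z01.
by rewrite -fg ?hp //; exists j => //; apply/segment_refmap.
Qed.

Lemma gradFB (R : realType) (N : nat) (G : ref_grid R N) l
    (f g : 'cV[R]_2 -> 'cV[R]_2) (j : 'I_N) (x : R) :
  fe_space2 G l f -> fe_space2 G l g -> 0 <= x <= 1 ->
  gradF G (fun y => f y - g y) j x = gradF G f j x - gradF G g j x.
Proof.
move=> hf hg x01; have [p hp] := fe_space2_poly j hf.
have [q hq] := fe_space2_poly j hg.
rewrite (gradF_poly hp x01) (gradF_poly hq x01).
rewrite (gradF_poly (p := fun k => p k - q k)) // => [|z z01].
  by apply/matrixP => k i; rewrite !mxE /vderiv derivB !hornerE.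
by rewrite hp // hq //; apply/matrixP => k i; rewrite !mxE !hornerE.
Qed.

(** Pointwise form of the decay of length: with a = X_s and t = Y_s this is
    [frob_sub_unit_ge] multiplied by the length density of [Y]. *)
Lemma sgrad2_length_ge (R : realType) (N : nat) (G : ref_grid R N) l
    (X Y : 'cV[R]_2 -> 'cV[R]_2) (j : 'I_N) (x : R) :
  fe_space2 G l X -> fe_space2 G l Y -> 0 <= x <= 1 ->
  0 < enorm (gradF G Y j x) ->
  enorm (gradF G X j x) - enorm (gradF G Y j x) <=
  frob (sgrad2 G Y X j x) (sgrad2 G Y (fun y => X y - Y y) j x) *
    enorm (gradF G Y j x).
Proof.
move=> hX hY x01 D0; have [c c0 hc] := ref_dtau_gradF G l j.
rewrite /sgrad2 frob_outer /dtau /tangent !hc //; last exact: fe_space2B.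
rewrite (gradFB j hX hY x01) !scalerA enormZ; move: D0.
move: (gradF G X j x) (gradF G Y j x) => F D D0.
set r := _ * c.
(* [r *: F] and [r *: D] are the arc length derivatives X_s and Y_s. *)
have rD : `|r| * enorm D = 1.
  rewrite normrM normfV normrM normr_id (ger0_norm (enorm_ge0 _)).
  by rewrite -mulrA mulVf // mulf_eq0 normr_eq0 negb_or c0 gt_eqF.
have t1 : frob (r *: D) (r *: D) = 1.
  by rewrite -sqr_enorm enormZ rD expr1n.
rewrite t1 mulr1 scalerBr.
have := frob_sub_unit_ge (r *: F) t1.
rewrite -(ler_pM2r D0) mulrBl mul1r enormZ.
by rewrite mulrAC rD mul1r.
Qed.

(** * Decay of the numerical perimeter *)

Lemma perimeterE (R : realType) (N Q : nat) (G : ref_grid R N)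
    (qr : quadrature R Q) Y :
  perimeter G qr Y = \sum_(j < N) \sum_(i < Q)
    enorm (gradF G Y j (qpoint qr i)) * qweight qr i.
Proof.
by apply: eq_bigr => j _; apply: eq_bigr => i _; rewrite !mul1r.
Qed.

Lemma perimeter_eq (R : realType) (N Q : nat) (G : ref_grid R N) l
    (qr : quadrature R Q) (X Y : 'cV[R]_2 -> 'cV[R]_2) :
  fe_space2 G l X -> (forall y, ref_curve G y -> X y = Y y) ->
  perimeter G qr X = perimeter G qr Y.
Proof.
move=> hX XY; rewrite !perimeterE; apply: eq_bigr => j _; apply: eq_bigr => i _.
by rewrite (gradF_eq _ hX XY) ?qpoint_in.
Qed.

(** Positivity of the weights lets the pointwise estimate be summed. *)
Lemma perimeter_sub_le (R : realType) (N Q : nat) (G : ref_grid R N) l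
    (qr : quadrature R Q) (X Y : 'cV[R]_2 -> 'cV[R]_2) :
  fe_space2 G l X -> fe_space2 G l Y -> assumption_A1h G qr Y ->
  perimeter G qr X - perimeter G qr Y <=
  qprod_mx G qr Y (sgrad2 G Y X) (sgrad2 G Y (fun y => X y - Y y)).
Proof.
move=> hX hY hA; rewrite !perimeterE -sumrB; apply: ler_sum => j _.
rewrite -sumrB; apply: ler_sum => i _; rewrite -mulrBl.
rewrite ler_wpM2r ?(ltW (qweight_gt0 _ _)) //.
by apply: sgrad2_length_ge hX hY _ (hA j i); exact: qpoint_in.
Qed.

(** One time step, tested with [kappa] and with the displacement [X - Y]. *)
Lemma scheme_step_stable (R : realType) (N Q l : nat) (G : ref_grid R N)
    (qr : quadrature R Q) (fl : flow) (s : bool) (tau : R)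
    (Y X : 'cV[R]_2 -> 'cV[R]_2) (kappa : 'cV[R]_2 -> R) :
  0 < tau -> fe_space2 G l Y -> assumption_A1h G qr Y ->
  scheme_step G qr l fl s tau Y X kappa ->
  perimeter G qr X <= perimeter G qr Y - tau * flow_form G qr fl Y kappa kappa.
Proof.
move=> tau0 hY hA [hX hk /(_ _ hk) <- /(_ _ (fe_space2B hX hY))].
set A := qprod_mx _ _ _ _ (pull _ _); set B := qprod_mx _ _ _ _ (sgrad2 _ _ _).
set C := qprod_mx _ _ _ _ _ => AB0.
(* Symmetry of the quadrature form turns the first equation, tested with
   [kappa], into the curvature term of the second. *)
have -> : tau * C = A.
  rewrite /C /A /qprod_mx /qprod mulr_sumr; apply: eq_bigr => j _.
  rewrite mulr_sumr; apply: eq_bigr => i _.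
  by rewrite /pull (frobZl tau^-1) [in LHS]frobC !mulrA divff ?mul1r // gt_eqF.
rewrite -lerBlDl; apply: le_trans (perimeter_sub_le hX hY hA) _.
by rewrite -/B -subr_ge0 -opprD AB0 oppr0.
Qed.

Lemma telescope_dissipation (R : realType) (c : R) (u v : nat -> R) n :
  (forall m, (m < n)%N -> u m.+1 <= u m - c * v m) ->
  u n <= u 0%N - c * \sum_(m < n) v m.
Proof.
elim: n => [_|n IH h]; first by rewrite big_ord0 mulr0 subr0.
apply: le_trans (h n (ltnSn n)) _; rewrite big_ord_recr mulrDr opprD addrA lerD2r.
by apply: IH => m /ltnW/h.
Qed.

Theorem theorem2p4 (R : realType) (N Q l M : nat) (G : ref_grid R N)
    (qr : quadrature R Q) (fl : flow) (s : bool) (tau : R)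
    (Y X : nat -> 'cV[R]_2 -> 'cV[R]_2) (kappa : nat -> 'cV[R]_2 -> R)
    (hl : (1 <= l)%N) (htau : 0 < tau)
    (hY0 : fe_space2 G l (Y 0%N))
    (hA1 : forall m, (m <= M)%N -> assumption_A1h G qr (Y m))
    (hstep : forall m, (m <= M)%N ->
      scheme_step G qr l fl s tau (Y m) (X m.+1) (kappa m.+1))
    (hnext : forall m, (m <= M)%N ->
      forall y, ref_curve G y -> Y m.+1 y = X m.+1 y) :
  perimeter G qr (Y M.+1) <=
  perimeter G qr (Y 0%N) -
  tau * \sum_(m < M.+1) flow_form G qr fl (Y m) (kappa m.+1) (kappa m.+1).
Proof.
have hXm m : (m <= M)%N -> fe_space2 G l (X m.+1) by move=> /hstep[].
(* Admissibility of X - Y as a test function at every step. *)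
have hYm m : (m <= M)%N -> fe_space2 G l (Y m).
  case: m => // m /ltnW mM.
  by apply: fe_space2_eq (hXm m mM) => y /(hnext _ mM).
pose v m := flow_form G qr fl (Y m) (kappa m.+1) (kappa m.+1).
apply: (@telescope_dissipation _ _ (fun n => perimeter G qr (Y n)) v) => m mM.
have -> : perimeter G qr (Y m.+1) = perimeter G qr (X m.+1).
  by apply/esym/(perimeter_eq qr (hXm m mM)) => y /(hnext m mM).
exact: scheme_step_stable htau (hYm m mM) (hA1 m mM) (hstep m mM).
Qed.
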